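(* Let $X$ and $Z$ be Hausdorff, locally convex topological vector spaces, let $C\subseteq Z$ be a convex, pointed cone with nonempty interior, and let $K$ be a nonempty, convex and compact subset of $X$. Let $D\subseteq K$ be a self segment-dense set in $K$ and consider a mapping $f:K\times K\to Z$ satisfying (i) for all $y\in D$, the mapping $x\mapsto f(x,y)$ is $C$-upper semicontinuous on $K$; (ii) for all $x\in K$, the mapping $y\mapsto f(x,y)$ is $C$-upper semicontinuous on $K\setminus D$; (iii) for all $x\in D$, the mapping $y\mapsto f(x,y)$ is $C$-convex on $D$; (iv) for all $x\in D$, $f(x,x)\notin -\operatorname{int} C$. Then there exists $x_0\in K$ such that $f(x_0,y)\notin -\operatorname{int} C$ for all $y\in K$.
   Context: All vector spaces are real. $\operatorname{int}$ denotes interior and $\operatorname{cl}$ closure. A set $C\subseteq Z$ is a cone if $tc\in C$ for all $c\in C$ and $t\ge 0$; it is convex if $C+C=C$, and pointed if $C\cap(-C)=\{0\}$. Write $z_1\le z_2$ iff $z_2-z_1\in C$. $C$-upper semicontinuity: a map $g:K\to Z$ is $C$-upper semicontinuous at $x\in K$ if for any neighborhood $V$ of $g(x)$ there exists a neighborhood $U$ of $x$ such that $g(u)\in V-C$ for all $u\in U\cap K$. It is $C$-upper semicontinuous on a subset $S\subseteq K$ if it is so, as a map on $K$, at every point of $S$. $C$-convexity: for a (not necessarily convex) set $D$, $g$ is $C$-convex on $D$ if for all $n\in\mathbb N$, $x_1,\dots,x_n\in D$ and $\lambda_1,\dots,\lambda_n\ge 0$ with $\sum_{i=1}^n\lambda_i=1$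 such that $\sum_{i=1}^n\lambda_i x_i\in D$, one has $g\left(\sum_{i=1}^n\lambda_i x_i\right)\le\sum_{i=1}^n\lambda_i g(x_i)$. Self segment-dense set: let $U\subseteq V\subseteq X$ with $V$ convex. $U$ is self segment-dense in $V$ if $U$ is dense in $V$ (i.e. $V\subseteq\operatorname{cl}U$) and for all $x,y\in U$ the set $[x,y]\cap U$ is dense in $[x,y]$, where $[x,y]=\{x+t(y-x):t\in[0,1]\}$. *)

(* Defs.v *)
(* Vector spaces are over an abstract R : realType; a locally
   convex topological vector space is the library's tvsType R.  A map defined on
   a subset K is encoded as a total function; the predicates below only look at
   its values on K (or on D). *)
From HB Require Import structures.
From mathcomp Require Import all_boot all_order all_algebra.
From mathcomp Require Import all_classical all_reals all_analysis.

Set Implicit Arguments.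
Unset Strict Implicit.
Unset Printing Implicit Defensive.

Import Order.TTheory GRing.Theory Num.Theory.

Local Open Scope classical_set_scope.
Local Open Scope ring_scope.

Definition minkowski_opp (Z : zmodType) (A : set Z) : set Z := [set - a | a in A].

Definition minkowski_add (Z : zmodType) (A B : set Z) : set Z :=
  [set a + b | a in A & b in B].

Definition minkowski_sub (Z : zmodType) (A B : set Z) : set Z :=
  [set a - b | a in A & b in B].

Definition is_cone (R : realType) (Z : lmodType R) (C : set Z) : Prop :=
  forall (c : Z) (t : R), C c -> 0 <= t -> C (t *: c).

Definition convex_cone (R : realType) (Z : lmodType R) (C : set Z) : Prop :=
  is_cone C /\ minkowski_add C C = C.

Definition pointed (Z : zmodType) (C : set Z) : Prop :=
  C `&` minkowski_opp C = [set 0].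

Definition cone_le (Z : zmodType) (C : set Z) (z1 z2 : Z) : Prop :=
  C (z2 - z1).

Definition usc_at (R : realType) (X Z : tvsType R) (C : set Z) (K : set X)
    (g : X -> Z) (x : X) : Prop :=
  forall V : set Z, nbhs (g x) V ->
    exists2 U : set X, nbhs x U &
      forall u : X, U u -> K u -> minkowski_sub V C (g u).

(* The neighbourhoods are relative to K, not to S. *)
Definition usc_on (R : realType) (X Z : tvsType R) (C : set Z) (K : set X)
    (g : X -> Z) (S : set X) : Prop :=
  forall x : X, S x -> usc_at C K g x.

Definition cone_convex_on (R : realType) (X Z : lmodType R) (C : set Z)
    (D : set X) (g : X -> Z) : Prop :=
  forall (n : nat) (x : 'I_n -> X) (l : 'I_n -> R),
    (forall i, D (x i)) ->
    (forall i, 0 <= l i) ->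
    \sum_(i < n) l i = 1 ->
    D (\sum_(i < n) l i *: x i) ->
    cone_le C (g (\sum_(i < n) l i *: x i)) (\sum_(i < n) l i *: g (x i)).

Definition segment (R : realType) (X : lmodType R) (x y : X) : set X :=
  [set x + t *: (y - x) | t in [set t : R | 0 <= t <= 1]].

Definition dense_in (T : topologicalType) (A B : set T) : Prop :=
  B `<=` closure A.

(* The convexity of V is not part of this predicate. *)
Definition self_segment_dense (R : realType) (X : tvsType R) (U V : set X)
    : Prop :=
  [/\ U `<=` V,
      dense_in U V &
      forall x y : X, U x -> U y ->
        dense_in (segment x y `&` U) (segment x y)].

(* Main.v *)
Require Import Defs.
From HB Require Import structures.
From mathcomp Require Import all_boot all_order all_algebra zify.

(** For [y] in [D] let [G y] be the set of [x] in [K] with [f x y] outside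
    [- int C]; it is closed by (i).  Let [u = \sum_i m_i y_i] be a convex
    combination of points of [D].  If [u] is in [D], then [u] lies in some [G y_i]
    with [m_i > 0]: otherwise (iii) would put [f u u] in [- int C].  Self
    segment-density makes the combinations lying in [D] dense among all of them,
    face by face, so this extends to every [u] by closedness.  The KKM lemma
    and compactness then give [x0] in all the [G y], [y] in [D], and (ii) with the
    density of [D] takes care of the other [y].

    KKM is obtained from Scarf's combinatorial lemma, a parity argument for a
    finite set with several total orders that replaces the triangulation in
    Sperner's lemma. *)

Set Implicit Arguments.
Unset Strict Implicit.
Unset Printing Implicit Defensive.

Import Order.TTheory GRing.Theory Num.Theory.

(** * Scarf's lemma *)

Section Scarf.
Context {d : Order.disp_t} {O : orderType d} {I S : finType}.
Variables (r : I -> S -> O).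
Hypothesis r_inj : forall i, injective (r i).

Definition dominant (P : {set S}) : bool :=
  [forall y, [exists i, [forall x in P, (r i y <= r i x)%O]]].

Lemma dominantP (P : {set S}) :
  reflect (forall y, exists i, forall x, x \in P -> (r i y <= r i x)%O)
          (dominant P).
Proof.
apply: (iffP forallP) => h y.
  have /existsP[i /forallP hi] := h y; exists i => x xP.
  exact: (implyP (hi x)).
have [i hi] := h y; apply/existsP; exists i; apply/forallP => x.
by apply/implyP => /hi.
Qed.

Lemma dominantS (P Q : {set S}) : Q \subset P -> dominant P -> dominant Q.
Proof.
move=> /subsetP QP /dominantP h; apply/dominantP => y; have [i hi] := h y.
by exists i => x /QP; exact: hi.
Qed.

(* The elements beating the minimum of [t] in all orders but the [k]-th one;
   completing [t] to a room amounts to picking a [k]-maximal such element. *)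
Definition beats (m : I -> S) (k : I) (y : S) : bool :=
  [forall l, (l != k) ==> (r l (m l) < r l y)%O].

Lemma beatsP (m : I -> S) (k : I) (y : S) :
  reflect (forall l, l != k -> (r l (m l) < r l y)%O) (beats m k y).
Proof.
apply: (iffP forallP) => h l; first by move=> lk; exact: (implyP (h l)).
by apply/implyP; exact: h.
Qed.

(** By dominance each element of [t] is the minimum [m i] in some order [i]. There is one order more
    than elements, so exactly one pair of orders shares its minimum. An added element must be the
    minimum in one of these two, where maximality determines it. *)
Lemma door_two_rooms (t : {set S}) :
  dominant t -> #|I| = #|t|.+1 -> t != set0 ->
  (forall k m, (forall i, m i \in t) ->
    (forall i x, x \in t -> (r i (m i) <= r i x)%O) -> exists y, beats m k y) ->
  #|[set x | (x \notin t) && dominant (x |: t)]| = 2.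
Proof.
move=> dt cI /set0Pn[x0 x0t] ne.
pose m i := [arg min_(x < x0 in t) r i x]%O.
have mt i : m i \in t by rewrite /m; case: arg_minP.
have mle i x : x \in t -> (r i (m i) <= r i x)%O.
  by rewrite /m; case: arg_minP => // j jt h /h.
have surj x : x \in t -> exists i, m i = x.
  move=> xt; have /dominantP/(_ x)[i hi] := dt.
  exists i; apply: (r_inj (i := i)); apply/le_anti; rewrite mle//=.
  by apply: hi.
have im : m @: [set: I] = t.
  apply/setP => x; apply/imsetP/idP => [[i _ ->]//|/surj[i <-]].
  by exists i.
have [i [j [ij mij]]] : exists i j, i != j /\ m i = m j.
  have /injectivePn[i [j ij mij]] : ~~ injectiveb m.
    apply/negP => /injectiveP mi; have := card_imset [set: I] mi.
    by rewrite im cardsT cI => /eqP; rewrite ltn_eqF.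
  by exists i, j.
have imk k k' : k != k' -> m k = m k' -> m @: [set~ k] = t.
  move=> kk' e; apply/setP => x; apply/imsetP/idP => [[l _ ->]//|/surj[l <-]].
  have [->|lk] := eqVneq l k; last by exists l; rewrite ?inE.
  by exists k'; rewrite ?inE // eq_sym.
have injk k k' : k != k' -> m k = m k' -> {in [set~ k] &, injective m}.
  move=> kk' e; apply/imset_injP; rewrite (imk _ _ kk' e).
  by rewrite cardsC1 cI.
pose room k x := beats m k x /\ (forall y, beats m k y -> (r k y <= r k x)%O).
have roomE k k' x : k != k' -> m k = m k' -> room k x ->
    (x \notin t) && dominant (x |: t).
  move=> kk' e [/beatsP bx mx]; apply/andP; split.
    apply/negP; rewrite -(imk _ _ kk' e) => /imsetP[l]; rewrite !inE => lk xl.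
    by have := bx l lk; rewrite xl ltxx.
  (* A [y] violating dominance satisfies [beats m k y]. As [x] is maximal among such elements, [y]
     then beats the minimum of [t] in order [k] too, against dominance of [t]. *)
  apply/dominantP => y.
  have [/existsP[l /forallP yl]|/existsPn hy] :=
      boolP [exists l, [forall x' in x |: t, (r l y <= r l x')%O]].
    by exists l => x' x't; exact: (implyP (yl x')).
  have {}hy l : exists2 p, p \in x |: t & (r l p < r l y)%O.
    have /forallPn[p] := hy l; rewrite negb_imply -ltNge => /andP[pt py].
    by exists p.
  have by_ : beats m k y.
    apply/beatsP => l lk; have [p] := hy l; rewrite !inE => /orP[/eqP->|pt].
      by apply: lt_trans; exact: bx.
    by apply: le_lt_trans; exact: mle.
  have [p pt py] := hy k.
  have : p \in t.
    move: pt; rewrite !inE => /orP[/eqP px|//].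
    by have := lt_le_trans py (mx _ by_); rewrite px ltxx.
  move=> /(mle k) mp; have /dominantP/(_ y)[l hl] := dt.
  have := hl _ (mt l); rewrite leNgt; have [->|lk] := eqVneq l k.
    by rewrite (le_lt_trans mp py).
  by move/beatsP: by_ => ->.
have Eroom x : x \notin t -> dominant (x |: t) -> room i x \/ room j x.
  move=> xt dx; have /dominantP hx := dx.
  have [k _] := hx x.
  (* In order [mu p] no element of [x |: t] lies below [p]. Dominance provides such an order, so the
     default [k] never occurs; by cardinality [mu] maps [x |: t] bijectively onto the orders. *)
  pose mu p := odflt k [pick l | [forall q in x |: t, (r l p <= r l q)%O]].
  have muP p q : q \in x |: t -> (r (mu p) p <= r (mu p) q)%O.
    move=> qP; rewrite /mu; case: pickP => [l /forallP/(_ q)/implyP/(_ qP)//|no].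
    have [l hl] := hx p; move/negP: (no l) => /=; case; apply/forallP => q'.
    by apply/implyP; exact: hl.
  have mu_inj : {in x |: t &, injective mu}.
    move=> p q pP qP e; apply: (r_inj (i := mu p)); apply/le_anti.
    by rewrite (muP p q)//= e (muP q p).
  have mu_surj l : exists2 p, p \in x |: t & mu p = l.
    have : l \in mu @: (x |: t).
      suff -> : mu @: (x |: t) = [set: I] by [].
      apply/eqP; rewrite eqEcard subsetT /= cardsT card_in_imset// cI cardsU1 xt.
      by [].
    by move=> /imsetP[p pP ->]; exists p.
  have mum p : p \in t -> m (mu p) = p.
    move=> pt; apply: (r_inj (i := mu p)); apply/le_anti.
    by rewrite mle//= muP// !inE ?mt ?pt orbT.
  have bx : beats m (mu x) x.
    apply/beatsP => l lx; have [p] := mu_surj l; rewrite !inE => /orP[/eqP->|pt].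
      by move=> e; rewrite e eqxx in lx.
    move=> <-; rewrite mum// lt_neqAle muP ?andbT ?inE ?eqxx ?pt ?orbT//.
    by apply/eqP => /r_inj pe; rewrite -pe pt in xt.
  have rx : room (mu x) x.
    split=> // y /beatsP hy; have [l hl] := hx y.
    have [<-|lk] := eqVneq l (mu x); first by apply: hl; rewrite !inE eqxx.
    have := hl (m l); rewrite !inE mt orbT => /(_ isT).
    by rewrite leNgt hy.
  have [e|ix] := eqVneq i (mu x); first by left; rewrite e.
  have [e|jx] := eqVneq j (mu x); first by right; rewrite e.
  have [p pP pi] := mu_surj i; have [q qP qj] := mu_surj j.
  have pt : p \in t.
    by move: pP; rewrite !inE => /orP[/eqP px|//]; rewrite -px pi eqxx in ix.
  have qt : q \in t.
    by move: qP; rewrite !inE => /orP[/eqP px|//]; rewrite -px qj eqxx in jx.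
  have : p = q by rewrite -(mum p pt) -(mum q qt) pi qj.
  by move=> e; move: ij; rewrite -pi -qj e eqxx.
have room_ex k : exists x, room k x.
  have [y yb] := ne k m mt mle.
  exists [arg max_(x > y | beats m k x) r k x]%O.
  by case: arg_maxP => // x bx h; split.
have [xi hi] := room_ex i; have [xj hj] := room_ex j.
have ji : j != i by rewrite eq_sym.
have uniq k x y : room k x -> room k y -> x = y.
  move=> [bx hx] [by_ hy]; apply: (r_inj (i := k)); apply/le_anti.
  by rewrite hx// hy.
have -> : [set x | (x \notin t) && dominant (x |: t)] = [set xi; xj].
  apply/setP => x; rewrite !inE; apply/idP/idP.
    case/andP => xt /(Eroom _ xt)[h|h]; first by rewrite (uniq _ _ _ h hi) eqxx.
    by rewrite (uniq _ _ _ h hj) eqxx orbT.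
  case/orP => /eqP->; first exact: roomE ij mij hi.
  by apply: roomE ji _ hj.
(* A common element would beat the minima of [t] in all orders. *)
rewrite cards2; suff -> : xi != xj by [].
apply/eqP => e; have /dominantP/(_ xi)[l hl] := dt.
have := hl _ (mt l); rewrite leNgt.
have [bi _] := hi; have [bj _] := hj; rewrite -e in bj.
have [->|li] := eqVneq l i; first by rewrite (beatsP _ _ _ bj).
by rewrite (beatsP _ _ _ bi).
Qed.


(* [s i] is a fictitious element standing for the facet of a simplex where the
   [i]-th coordinate vanishes. *)
Lemma scarf (s : I -> S) (c : S -> I) (x0 : S) :
  (forall i y, y != s i -> (r i (s i) < r i y)%O) ->
  (forall i k x, k != i -> x \notin codom s -> (r i x < r i (s k))%O) ->
  injective s -> x0 \notin codom s -> (forall i, c (s i) = i) ->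
  exists2 P : {set S}, dominant P & c @: P = [set: I].
Proof.
move=> lo hi s_inj x0s cs; pose i0 := c x0.
have [/existsP[P /andP[dP /eqP cP]]|/existsPn none] :=
  boolP [exists P : {set S}, dominant P && (c @: P == [set: I])].
  by exists P.
exfalso.
have I_gt0 : 0 < #|I| by apply/card_gt0P; exists i0.
(* [N] counts the pairs of a room and an element whose deletion leaves every colour except [i0]. *)
pose room (P : {set S}) := dominant P && (#|P| == #|I|).
pose door (t : {set S}) := c @: t == [set~ i0].
pose N := \sum_(P : {set S} | room P) #|[set x in P | door (P :\ x)]|.
(* A room has no door or two: since no room shows all colours, in a room with a door exactly one
   colour occurs twice, and either of its carriers may be deleted. *)
have evenN : 2 %| N.
  apply: dvdn_sum => P /andP[dP /eqP cardP].
  have [->|/set0Pn[x1]] := eqVneq [set x in P | door (P :\ x)] set0.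
    by rewrite cards0.
  rewrite !inE => /andP[x1P dx1].
  have inj x : x \in P -> door (P :\ x) -> {in P :\ x &, injective c}.
    move=> xP /eqP e; apply/imset_injP; rewrite e cardsC1 -cardP.
    by rewrite (cardsD1 x P) xP.
  have cP x : x \in P -> c @: P = c x |: c @: (P :\ x).
    by move=> xP; rewrite -imsetU1 setD1K.
  have c1 : c x1 != i0.
    apply/eqP => e; have := none P; rewrite dP/= (cP _ x1P) (eqP dx1) e.
    by rewrite setUCr eqxx.
  have : c x1 \in c @: (P :\ x1) by rewrite (eqP dx1) !inE.
  move=> /imsetP[x2]; rewrite !inE => /andP[x21 x2P] c12.
  have dx2 : door (P :\ x2).
    have e : c @: (P :\ x1) = c @: P.
      rewrite (cP _ x1P) c12; apply/esym/setUidPr; rewrite sub1set.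
      by rewrite imset_f// !inE x21.
    rewrite /door -(eqP dx1) e (cP _ x2P) -c12 eq_sym; apply/eqP/setUidPr.
    by rewrite sub1set imset_f// !inE eq_sym x21.
  suff -> : [set x in P | door (P :\ x)] = [set x1; x2].
    by rewrite cards2 eq_sym x21.
  apply/setP => x; rewrite !inE; apply/andP/orP => [[xP dx]|]; last first.
    by move=> [/eqP->|/eqP->].
  have [/eqP|xx1] := eqVneq x x1; first by left.
  have [/eqP|xx2] := eqVneq x x2; first by right.
  have : x1 = x2 by apply: (inj x xP dx); rewrite // !inE eq_sym ?xx1 ?xx2.
  by move=> e; rewrite e eqxx in x21.
pose M (t : {set S}) := #|[set x | (x \notin t) && dominant (x |: t)]|.
(* The same pairs, grouped by door: [P] corresponds to [x |: t]. *)
have NE : N = \sum_(t : {set S} | [&& dominant t, door t & #|I| == #|t|.+1]) M t.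
  rewrite /N.
  under eq_bigr => P _ do rewrite -sum1_card big_mkcond.
  rewrite [RHS](eq_bigr (fun t : {set S} =>
    \sum_x if (x \notin t) && dominant (x |: t) then 1 else 0)); last first.
    move=> t _; rewrite /M -sum1_card big_mkcond.
    by apply: eq_bigr => x _; rewrite inE.
  rewrite exchange_big/= [RHS]exchange_big/=; apply: eq_bigr => x _.
  rewrite -!big_mkcondr/=.
  rewrite [LHS](reindex_onto (fun t => x |: t) (fun P => P :\ x))/=; last first.
    by move=> P /andP[_]; rewrite inE => /andP[xP _]; rewrite setD1K.
  apply: eq_bigl => t; rewrite !inE eqxx /= /room.
  have [xt|xt] := boolP (x \in t).
    rewrite (_ : _ == t = false) ?andbF ?andbF//.
    by apply/eqP => /setP/(_ x); rewrite !inE eqxx xt.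
  rewrite setU1K// eqxx !andbT cardsU1 xt/= add1n (eq_sym #|I|).
  have [dxt|] := boolP (dominant (x |: t)); last by rewrite !(andbF, andFb).
  by rewrite (dominantS (subsetUr [set x] t) dxt)/= andbT andbC.
(* the only door lying on the boundary *)
pose t0 := s @: [set~ i0].
have ht0 : [&& dominant t0, door t0 & #|I| == #|t0|.+1].
  rewrite /door /t0 card_imset// cardsC1 prednK// eqxx andbT.
  rewrite -imset_comp (eq_imset _ (g := id)) ?imset_id ?eqxx ?andbT//=.
  apply/dominantP => y.
  have [/codomP[j ->]|ys] := boolP (y \in codom s).
    exists j => x _; have [->//|xj] := eqVneq x (s j).
    by rewrite ltW// lo.
  by exists i0 => x /imsetP[k]; rewrite !inE => ki ->; rewrite ltW// hi.
(* Dominance forces the added element to be the largest non-fictitious one in order [i0]. *)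
have Mt0 : M t0 = 1.
  pose x := [arg max_(x > x0 | x \notin codom s) r i0 x]%O.
  have [xs xm] : x \notin codom s /\
      forall y, y \notin codom s -> (r i0 y <= r i0 x)%O.
    by rewrite /x; case: arg_maxP.
  rewrite /M; suff -> : [set x | (x \notin t0) && dominant (x |: t0)] = [set x].
    by rewrite cards1.
  have nt0 z : z \notin codom s -> z \notin t0.
    by apply: contra => /imsetP[k _ ->]; exact: codom_f.
  have key z y : dominant (z |: t0) -> y \notin codom s -> (r i0 y <= r i0 z)%O.
    move=> /dominantP/(_ y)[l hl] ys.
    have [<-|li] := eqVneq l i0; first by apply: hl; rewrite !inE eqxx.
    have := hl (s l); rewrite !inE imset_f ?inE// orbT => /(_ isT).
    rewrite leNgt lo//; apply/eqP => ysl.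
    by move: ys; rewrite ysl codom_f.
  apply/setP => z; rewrite !inE; apply/andP/eqP => [[zt dz]|->].
    have zs : z \notin codom s.
      apply/negP => /codomP[k zk].
      have ki : k = i0.
        by apply/eqP; apply: contraNT zt => ki; rewrite zk imset_f// !inE.
      have := key z x0 dz x0s; rewrite zk ki leNgt lo//.
      by apply: contraNneq x0s => ->; exact: codom_f.
    by apply: (r_inj (i := i0)); apply/le_anti; rewrite xm// key.
  split; first exact: nt0.
  apply/dominantP => y.
  have [/codomP[j ->]|ys] := boolP (y \in codom s).
    exists j => z' _; have [->//|xj] := eqVneq z' (s j).
    by rewrite ltW// lo.
  exists i0 => z'; rewrite !inE => /orP[/eqP->|]; first exact: xm.
  by move=> /imsetP[k]; rewrite !inE => ki ->; rewrite ltW// hi.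
move: evenN; rewrite NE (bigD1 t0)//= Mt0 dvdn_addl ?dvdn1//.
apply: dvdn_sum => t /andP[/and3P[dt ct /eqP cardt] tt0].
(* By cardinality such a door would consist of all fictitious elements but [s l]; its colours then
   give [l = i0], so it would be [t0]. *)
have notbd l : ~~ (t \subset s @: [set~ l]).
  apply/negP => tl; have tE : t = s @: [set~ l].
    apply/eqP; rewrite eqEcard tl card_imset// cardsC1 cardt.
    by rewrite leqnn.
  move: ct; rewrite /door tE -imset_comp (eq_imset _ (g := id)) ?imset_id//=.
  move=> /eqP/(congr1 (@setC I)); rewrite !setCK => /setP/(_ l).
  by rewrite !inE eqxx => /esym/eqP li; rewrite tE li eqxx in tt0.
rewrite /M door_two_rooms//.
  apply/eqP => t_eq0; have := notbd i0.
  by rewrite t_eq0 sub0set.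
(* [s k] beats [m l] if this is not fictitious or equals [s l]. If it is another [s p], minimality
   puts [t] inside the set excluded by [notbd]. *)
move=> k m mt mle; exists (s k); apply/beatsP => l lk.
have [/codomP[p mp]|ms] := boolP (m l \in codom s); last by rewrite hi// eq_sym.
have [pl|pl] := eqVneq p l.
  by rewrite mp pl lo//; apply: contra lk => /eqP/s_inj->.
case/negP: (notbd l); apply/subsetP => x xt.
have := mle l x xt; rewrite leNgt mp => lx.
have [/codomP[q xq]|xs] := boolP (x \in codom s); last by rewrite hi in lx.
rewrite xq imset_f// !inE; apply/eqP => ql; move: lx; rewrite xq ql lo//.
by apply: contra pl => /eqP/s_inj->.
Qed.

End Scarf.

(** * Colourings of the integer points of a simplex *)

(** Scarf's lemma is applied to the grid points, ordered by each coordinate, with one fictitious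
    element per coordinate. A colour shown by no grid point of the dominant set belongs to a
    fictitious element in it, and then that coordinate is small. *)
Lemma grid_coloring (n N : nat) (c : ('I_n.+1 -> nat) -> 'I_n.+1) :
  exists x : 'I_n.+1 -> nat, \sum_i x i = N /\
    forall l, x l <= n.+1 \/
      exists x' : 'I_n.+1 -> nat, [/\ \sum_i x' i = N, c x' = l &
        forall m, x m <= x' m + n.+1 /\ x' m <= x m + n.+1].
Proof.
pose T := {x : {ffun 'I_n.+1 -> 'I_N.+1} | \sum_i x i == N}.
pose pt (x : T) (i : 'I_n.+1) : nat := val x i.
have pt_sum x : \sum_i pt x i = N by apply/eqP; exact: (valP x).
have pt_ex (y : 'I_n.+1 -> nat) : \sum_i y i = N -> exists x : T, pt x =1 y.
  move=> yN.
  have yle i : y i <= N by rewrite -yN (bigD1 i)//= leq_addr.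
  pose z : {ffun 'I_n.+1 -> 'I_N.+1} := [ffun i => inord (y i)].
  have zy i : z i = y i :> nat by rewrite ffunE inordK// ltnS.
  have zN : \sum_i z i == N by rewrite -[X in _ == X]yN; apply/eqP/eq_bigr.
  by exists (exist (fun x : {ffun 'I_n.+1 -> 'I_N.+1} => \sum_i x i == N) z zN).
(* The shift by one leaves [0] for the fictitious element [i], below all grid points; the others get
   [N.+2], above them. The second component breaks ties. *)
pose r (i : 'I_n.+1) (p : T + 'I_n.+1) : (nat *l nat)%type :=
  match p with
  | inl x => ((pt x i).+1, nat_of_ord (enum_rank x))
  | inr j => (if j == i then 0 else N.+2, nat_of_ord j)
  end.
have ltN x i : (pt x i).+1 < N.+2 by rewrite ltnS /pt ltn_ord.
have r_inj i : injective (r i).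
  move=> [x|j] [x'|j'] []/=.
  - by move=> _ /val_inj/enum_rank_inj->.
  - by case: eqP => //= _ [e] _; have := ltN x i; rewrite e ltnn.
  - by case: eqP => //= _ [e] _; have := ltN x' i; rewrite -e ltnn.
  - by move=> _ /val_inj->.
have [x0 _] : exists x : T, pt x =1 (fun i => if i == ord0 then N else 0).
  by apply: pt_ex; rewrite -big_mkcond big_pred1_eq.
pose col (p : T + 'I_n.+1) := match p with inl x => c (pt x) | inr j => j end.
have nslack x : inl x \notin codom (@inr T 'I_n.+1).
  by apply/codomP => -[].
have inr_inj : injective (@inr T 'I_n.+1) by move=> i j [].
have [||P /dominantP dP cP] :=
  scarf r_inj (c := col) _ _ inr_inj (nslack x0) (fun=> erefl).
- move=> i [x|j] /= ne; rewrite /r eqxx ltxi_pair//=.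
  have ji : j != i by apply: contra ne => /eqP->.
  by rewrite (negPf ji)/=.
- move=> i k [x|j] /= ki; last by rewrite codom_f.
  move=> _; rewrite (negPf ki) ltxi_pair !leEnat.
  by rewrite ltnW ?ltN//= leqNgt ltN.
have le_r i x x' : (r i (inl x) <= r i (inl x'))%O -> pt x i <= pt x' i.
  by rewrite lexi_pair/= leEnat ltnS => /andP[].
have dom y : exists2 l, inr l \notin P & forall x, inl x \in P -> pt y l <= pt x l.
  have [l hl] := dP (inl y); exists l => [|x /hl/le_r//].
  apply/negP => /hl; by rewrite /r eqxx lexi_pair.
have colP l : inr l \notin P -> exists2 x, inl x \in P & c (pt x) = l.
  move=> lP; have : l \in col @: P by rewrite cP.
  move=> /imsetP[[x|j] xP e]; first by exists x.
  by move: xP; rewrite -[j]/(col (inr j)) -e (negPf lP).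
have [l0 l0P _] := dom x0; have [x1 x1P _] := colP l0 l0P.
pose m l := [arg min_(x < x1 | inl x \in P) pt x l].
pose a l := if inr l \in P then 0 else pt (m l) l.
pose b l : nat := inr l \notin P.
have mP l : inl (m l) \in P by rewrite /m; case: arg_minnP.
have a_le l x : inl x \in P -> a l <= pt x l.
  rewrite /a; case: ifP => // _ xP.
  by rewrite /m; case: arg_minnP => // y _; exact.
have b_le : \sum_l b l <= n.+1.
  rewrite -[X in _ <= X]card_ord -sum1_card; apply: leq_sum => l _.
  by rewrite /b; case: (_ \notin _).
(* Otherwise [a + b], with the surplus put on [l0], is a grid point exceeding the minimum over [P]
   in every coordinate whose fictitious element is absent, against [dom]. *)
have aN : N < \sum_l a l + \sum_l b l.
  rewrite ltnNge; apply/negP => le_N; rewrite -big_split/= in le_N.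
  set s := \sum_l _ in le_N.
  have [|y hy] := pt_ex (fun l => a l + b l + (if l == l0 then N - s else 0)).
    by rewrite big_split/= -/s -big_mkcond big_pred1_eq subnKC.
  have [l lP hl] := dom y; have := hl _ (mP l).
  by rewrite hy /a /b (negPf lP)/= -addnA -[X in _ <= X]addn0 leq_add2l add1n.
(* The excess over [a] in one coordinate is at most [N - \sum_i a i], which is less than
   [\sum_l b l]. *)
have near x l : inl x \in P -> pt x l <= a l + n.+1.
  move=> xP.
  have : \sum_i a i + (pt x l - a l) <= N.
    rewrite -(pt_sum x) (bigD1 l)//= [X in _ <= X](bigD1 l)//= addnAC subnKC ?a_le//.
    by rewrite leq_add2l; apply: leq_sum => i _; exact: a_le.
  have := a_le l x xP; move: aN b_le; lia.
exists (pt x1); split=> // l; have [lP|lP] := boolP (inr l \in P).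
  by left; have := near _ l x1P; rewrite /a lP.
right; have [x xP cx] := colP l lP; exists (pt x); split=> // i.
have := near _ i x1P; have := near _ i xP.
have := a_le i _ x1P; have := a_le i _ xP; lia.
Qed.

(* Imported only here: [classical_sets] shadows the [finset] names used above. *)
From mathcomp Require Import all_classical all_reals all_analysis.
Import numFieldNormedType.Exports.

Local Open Scope classical_set_scope.
Local Open Scope ring_scope.

(** * The Knaster-Kuratowski-Mazurkiewicz lemma *)

Definition simplex (R : realType) (n : nat) : set 'rV[R]_n :=
  [set x | (forall i, 0 <= x ord0 i) /\ \sum_i x ord0 i = 1].
Arguments simplex {R n}.

Lemma continuous_sum (K : numDomainType) (V : tvsType K) (T : topologicalType)
    (I : finType) (F : I -> T -> V) :
  (forall i, continuous (F i)) -> continuous (fun x => \sum_i F i x).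
Proof.
by move=> cF; apply: continuous_big => //; exact: add_continuous.
Qed.

Lemma coord_sum_continuous (R : realType) (n : nat) :
  continuous (fun x : 'rV[R]_n => \sum_i x ord0 i).
Proof.
apply: (@continuous_sum R R^o); move=> i; exact: coord_continuous.
Qed.

Lemma simplex_closed (R : realType) (n : nat) : closed (@simplex R n).
Proof.
have -> : @simplex R n =
    (\bigcap_(i in [set: 'I_n])
      (fun x : 'rV[R]_n => x ord0 i) @^-1` [set t | 0 <= t])
    `&` (fun x : 'rV[R]_n => \sum_i x ord0 i) @^-1` [set 1].
  apply/seteqP; split=> x /=; first by move=> [x0 x1]; split=> // i _; exact: x0.
  by move=> [x0 x1]; split=> // i; exact: x0.
apply: closedI.
  apply: closed_bigI => i _; apply: preimage_closed; last exact: closed_ge.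
  by move=> x _; exact: coord_continuous.
apply: preimage_closed; last exact: closed_eq.
by move=> x _; exact: coord_sum_continuous.
Qed.

Lemma simplex_compact (R : realType) (n : nat) : compact (@simplex R n).
Proof.
have cptI : compact [set v : 'rV[R]_n | forall i, `[0, 1]%classic (v ord0 i)].
  by apply: (@rV_compact R n (fun=> `[0, 1]%classic)) => i; exact: segment_compact.
apply: (subclosed_compact (@simplex_closed R n) cptI) => x [x0 x1] i /=.
rewrite in_itv/= x0/= -x1 (bigD1 i)//= lerDl; exact: sumr_ge0.
Qed.

(* A multicoloured set need not show all the colours, but a missing one belongs to
   an almost vanishing coordinate. *)
Lemma simplex_coloring (R : realType) (n : nat)
    (psi : 'I_n.+1 -> 'rV[R]_n.+1 -> Prop) (e : R) :
  0 < e -> (forall x, simplex x -> exists i, psi i x) ->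
  exists x, simplex x /\ forall i, x ord0 i < e \/
    exists x', [/\ simplex x', psi i x' & ball x e x'].
Proof.
move=> e0 hpsi.
(* Fine enough that [n.+1] grid steps of length [1 / N] stay below [e]. *)
pose N := (Num.trunc (n.+1%:R / e)).+1.
have N0 : 0 < N%:R :> R by rewrite ltr0n.
have Ne : n.+1%:R / N%:R < e.
  rewrite ltr_pdivrMr// mulrC -ltr_pdivrMr//.
  exact: truncnS_gt.
pose pt (x : 'I_n.+1 -> nat) : 'rV[R]_n.+1 := \row_i ((x i)%:R / N%:R).
have pt_simplex x : \sum_i x i = N -> simplex (pt x).
  move=> xN; split=> [i|]; first by rewrite mxE divr_ge0.
  under eq_bigr do rewrite mxE.
  by rewrite -mulr_suml -natr_sum xN divff// gt_eqF.
have colP x : exists i, \sum_i x i = N -> psi i (pt x).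
  have [xN|xN] := pselect (\sum_i x i = N).
    by have [i hi] := hpsi _ (pt_simplex x xN); exists i.
  by exists ord0.
have [c hc] := choice colP.
have [x [xN hx]] := grid_coloring N c.
have lt_e (u v : nat) : (u <= v + n.+1)%N -> u%:R / N%:R - v%:R / N%:R < e.
  move=> uv; apply: le_lt_trans Ne.
  by rewrite -mulrBl ler_pM2r ?invr_gt0// lerBlDl -natrD ler_nat.
exists (pt x); split=> [|i]; first exact: pt_simplex.
have [xi|[x' [x'N cx' xx']]] := hx i.
  left; rewrite mxE; apply: le_lt_trans Ne.
  by rewrite ler_pM2r ?invr_gt0// ler_nat.
right; exists (pt x'); split; first exact: pt_simplex.
  by rewrite -cx'; exact: hc.
split=> // j k; have [xk x'k] := xx' k.
by rewrite /ball/= !mxE ltr_norml lt_e// andbT ltrNl opprB lt_e.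
Qed.

(** The distance to [F] works; it is infinite for empty [F], where the constant [1] replaces it. *)
Lemma closed_zero_set (R : realType) (V : normedModType R) (F : set V) :
  closed F -> exists d : V -> R,
    [/\ continuous d, forall x, 0 <= d x & forall x, d x = 0 <-> F x].
Proof.
move=> Fcl; have [->|/set0P[a Fa]] := eqVneq F set0.
  exists (fun=> 1); split=> // x; first exact: cvg_cst.
  by split=> // /eqP; rewrite oner_eq0.
have fin x : edist_inf F x \is a fin_num.
  rewrite ge0_fin_numE ?edist_inf_ge0//.
  apply: (@le_lt_trans _ _ (edist (x, a))).
    by apply: ereal_inf_lbound; exists a.
  rewrite -ge0_fin_numE ?edist_ge0//; apply/edist_finP.
  exists (`|x - a| + 1); first by rewrite ltr_wpDl.
  by rewrite -ball_normE /ball_/= ltrDl.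
exists (fine \o edist_inf F); split=> x /=.
- apply: fine_cvg; rewrite fineK//; exact: edist_inf_continuous.
- by rewrite fine_ge0// edist_inf_ge0.
split=> [d0|Fx]; last by rewrite edist_inf0.
apply: Fcl => B /nbhs_ballP[r /= r0 rB].
have : (edist_inf F x < r%:E)%E by rewrite -(fineK (fin x)) d0 lte_fin.
move=> /ereal_inf_lt[_ [y Fy <-] /edist_lt_ball xy].
by exists y; split=> //; exact: rB.
Qed.

(* The covering hypothesis says that each face lies in the union of the sets
   attached to its vertices. *)
Lemma kkm (R : realType) (n : nat) (F : 'I_n.+1 -> set 'rV[R]_n.+1) :
  (forall i, closed (F i)) ->
  (forall x, simplex x -> exists2 i, 0 < x ord0 i & F i x) ->
  exists2 x, simplex x & forall i, F i x.
Proof.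
move=> Fcl cov.
have [d dP] := choice (fun i => closed_zero_set (Fcl i)).
have dc i : continuous (d i) by have [] := dP i.
have d_ge0 i x : 0 <= d i x by have [] := dP i.
have dF i x : d i x = 0 <-> F i x by have [] := dP i.
pose S x := \sum_j d j x.
have Sc : continuous S by apply: (@continuous_sum R R^o).
have S_ge0 x : 0 <= S x by exact: sumr_ge0.
(* Summing over [i] forces equality: [x] is a fixed point of the Brouwer map
   [x |-> d x / S x], unless [S x = 0]. *)
suff [x xs hx] : exists2 x, simplex x & forall i, x ord0 i * S x <= d i x.
  have eq_d i : d i x = x ord0 i * S x.
    have ge0 j : true -> 0 <= d j x - x ord0 j * S x by rewrite subr_ge0.
    have sum0 : \sum_j (d j x - x ord0 j * S x) = 0.
      by rewrite sumrB -mulr_suml xs.2 mul1r subrr.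
    by apply/eqP; rewrite -subr_eq0; apply/eqP; exact: (psumr_eq0P ge0 sum0).
  have [i xi /dF] := cov x xs; rewrite eq_d => /eqP.
  rewrite mulf_eq0 gt_eqF//= => /eqP Sx0.
  by exists x => // j; apply/dF; rewrite eq_d Sx0 mulr0.
(* If every inequality failed, their sum would give [S x < S x]. *)
have cover_psi x : simplex x -> exists i, x ord0 i * S x <= d i x.
  move=> [_ x1]; apply/not_existsP => h.
  suff : S x < S x by rewrite ltxx.
  rewrite -{2}[S x]mul1r -x1 mulr_suml /S; apply: ltr_sum => [|i _].
    by apply/hasP; exists ord0; rewrite ?mem_index_enum.
  by rewrite ltNge; apply/negP; exact: h.
have e_gt0 k : 0 < k.+1%:R^-1 :> R by rewrite invr_gt0.
have [x xP] := choice (fun k => simplex_coloring (e_gt0 k) cover_psi).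
have [p [ps clp]] : simplex `&` cluster (x @ \oo) !=set0.
  apply: simplex_compact; exists 0%N => // k _; exact: (xP k).1.
exists p => // i; rewrite leNgt; apply/negP => dlt.
have pi_gt0 : 0 < p ord0 i.
  rewrite lt_neqAle (ps.1 i) andbT; apply/eqP => pi0.
  by move: dlt; rewrite -pi0 mul0r ltNge d_ge0.
pose g (y : 'rV[R]_n.+1) := y ord0 i * S y - d i y.
have gc : continuous g.
  move=> y.
  have mc : {for y, continuous (fun z : 'rV[R]_n.+1 => z ord0 i * S z)}.
    by apply: continuousM; [exact: coord_continuous|exact: Sc].
  exact: (continuousB mc (dc i y)).
have : \forall y \near p, 0 < g y.
  by apply: cvgr_gt (gc p) _ _; rewrite subr_gt0.
move=> /nbhs_ballP[r0 /= r0_gt0 hr0].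
(* Within [r0] of [p] the inequality required of [x'] fails, and [r <= p ord0 i] keeps the [i]-th
   coordinate from dropping below [r / 2] within [r / 2] of [p]. *)
pose r := Num.min r0 (p ord0 i).
have r_gt0 : 0 < r by rewrite lt_min r0_gt0.
have r2_gt0 : 0 < r / 2 by rewrite divr_gt0.
pose A := x @` [set k | k.+1%:R^-1 < r / 2].
have nearA : (x @ \oo) A.
  have : \forall k \near \oo, k.+1%:R^-1 < r / 2.
    exact: near_infty_natSinv_lt (PosNum r2_gt0).
  by apply: filterS => k; exists k.
have [_ [[k ke <-] pxk]] := clp _ _ nearA (nbhsx_ballx p _ r2_gt0).
have [_ /(_ i)[xki|[x' [x's psi' xx']]]] := xP k.
  have [_ /(_ ord0 i)] := pxk; rewrite /ball/= => /(le_lt_trans (ler_norm _)).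
  move=> /ltrD/(_ (lt_trans xki ke)); rewrite subrK -splitr ltNge.
  by rewrite ge_min lexx orbT.
have : ball p r x'.
  rewrite (splitr r); apply: ball_triangle pxk _.
  by apply: le_ball xx'; exact: ltW.
have rr0 : r <= r0 by rewrite ge_min lexx.
by move=> /(le_ball rr0)/hr0; rewrite /g/= subr_gt0 ltNge psi'.
Qed.

(** * Convex combinations and cones in topological vector spaces *)

Section Tvs.
Context {R : realType} {V : tvsType R}.

Lemma tvs_cvgD (T : Type) (F : set_system T) {FF : Filter F} (f g : T -> V)
    (a b : V) :
  f @ F --> a -> g @ F --> b -> (fun x => f x + g x) @ F --> a + b.
Proof.
by apply: (@continuous2_cvg _ _ _ _ _ _ _ _ +%R);
  exact: (@add_continuous V (a, b)).
Qed.

Lemma tvs_cvgZ (T : Type) (F : set_system T) {FF : Filter F}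
    (k : T -> R^o) (f : T -> V)    (l : R^o) (a : V) :
  k @ F --> l -> f @ F --> a ->
  (fun x => k x *: f x) @ F --> l *: a.
Proof.
move=> kl.
apply: (continuous2_cvg _ (h := fun (c : R^o) (v : V) => c *: v) _ kl).
exact: (@scale_continuous R V (l, a)).
Qed.

Lemma affine_continuous (t : R) (v : V) : continuous (fun w : V => t *: w + v).
Proof.
move=> w; apply: tvs_cvgD; last exact: cvg_cst.
by apply: tvs_cvgZ; [exact: cvg_cst|exact: cvg_id].
Qed.

Lemma combination_continuous (n : nat) (y : 'I_n -> V) :
  continuous (fun l : 'rV[R]_n => \sum_i l ord0 i *: y i).
Proof.
apply: continuous_sum => i l.
exact: (tvs_cvgZ (@coord_continuous R 1 n ord0 i l) (cvg_cst (y i))).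
Qed.

(* A combination of [y 0, ..., y n] lies on a segment from [y 0] to a combination
   of the others; approximate first the latter within [D], then the point. *)
Lemma combination_dense (D : set V) :
  (forall x y, D x -> D y -> dense_in (segment x y `&` D) (segment x y)) ->
  forall (n : nat) (y : 'I_n -> V) (l : 'I_n -> R) (U : set V),
  (forall i, D (y i)) -> (forall i, 0 <= l i) -> \sum_i l i = 1 ->
  nbhs (\sum_i l i *: y i) U ->
  exists m : 'I_n -> R,
    [/\ forall i, 0 <= m i, \sum_i m i = 1, forall i, l i = 0 -> m i = 0,
        D (\sum_i m i *: y i) & U (\sum_i m i *: y i)].
Proof.
move=> segD; elim=> [|n IH] y l U Dy l0 l1 Ul.
  by move: l1; rewrite big_ord0 => /eqP; rewrite eq_sym oner_eq0.
pose y' i := y (lift ord0 i); pose l' i := l (lift ord0 i).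
have Dy' i : D (y' i) by exact: Dy.
pose ext (a : R) (m : 'I_n -> R) i := if unlift ord0 i is Some j then m j else a.
have ext0 a m : ext a m ord0 = a by rewrite /ext unlift_none.
have extS a m i : ext a m (lift ord0 i) = m i by rewrite /ext liftK.
have extP a m (P : 'I_n.+1 -> R -> Prop) : P ord0 a ->
    (forall i, P (lift ord0 i) (m i)) -> forall i, P i (ext a m i).
  move=> Pa Pm i; case: (unliftP ord0 i) => [j ->|->]; first by rewrite extS.
  by rewrite ext0.
have ext_sum a m : \sum_i ext a m i = a + \sum_i m i.
  by rewrite big_ord_recl ext0; congr (_ + _); apply: eq_bigr => i _; rewrite extS.
have ext_comb a m : \sum_i ext a m i *: y i = a *: y ord0 + \sum_i m i *: y' i.
  by rewrite big_ord_recl ext0; congr (_ + _); apply: eq_bigr => i _; rewrite extS.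
have l'_sum : \sum_i l' i = 1 - l ord0.
  by rewrite -l1 big_ord_recl addrC addKr.
have [t0|t0] := eqVneq (l ord0) 0.
  have [||//|m [m0 m1 ml Dm Um]] := IH y' l' U Dy'.
  - by move=> i; exact: l0.
  - by rewrite l'_sum t0 subr0.
  - by move: Ul; rewrite big_ord_recl t0 scale0r add0r.
  exists (ext 0 m); rewrite ext_sum ext_comb scale0r !add0r; split=> //.
  + by apply: (extP _ _ (fun _ => >= 0)).
  + by apply: (extP _ _ (fun i a => l i = 0 -> a = 0)).
have [t1|t1] := eqVneq (l ord0) 1.
  have l'0 i : l' i = 0.
    have l'_sum0 : \sum_j l' j = 0 by rewrite l'_sum t1 subrr.
    exact: (psumr_eq0P (fun j _ => l0 (lift ord0 j)) l'_sum0).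
  have E : \sum_i l i *: y i = y ord0.
    rewrite big_ord_recl t1 scale1r big1 ?addr0// => i _.
    by rewrite -/(l' i) l'0 scale0r.
  exists l; split=> //; rewrite E//.
  by apply: nbhs_singleton; rewrite -E.
set t := l ord0 in t0 t1 l'_sum.
have t_le1 : t <= 1.
  by rewrite -l1 big_ord_recl lerDl; apply: sumr_ge0.
have ct_gt0 : 0 < 1 - t by rewrite subr_gt0 lt_neqAle t1.
have ct_neq0 : 1 - t != 0 by rewrite gt_eqF.
have E : \sum_i l i *: y i =
    (1 - t) *: (\sum_i ((1 - t)^-1 * l' i) *: y' i) + t *: y ord0.
  rewrite big_ord_recl addrC; congr (_ + _); rewrite scaler_sumr.
  by apply: eq_bigr => i _; rewrite scalerA mulrA mulfV// mul1r.
rewrite E in Ul.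
(* Pulling back the interior of [U] keeps [U] a neighbourhood of the point after the other vertices'
   combination has moved to [z], as the second approximation requires. *)
have := @affine_continuous (1 - t) (t *: y ord0) _ _ (nbhs_interior Ul).
move=> /(IH y' _ _ Dy')[||m [m0 m1 ml Dm Wm]].
- by move=> i; apply: mulr_ge0; [rewrite invr_ge0 ltW|exact: l0].
- by rewrite -mulr_sumr l'_sum mulVf.
set z := \sum_i m i *: y' i in Dm Wm.
have segz : segment z (y ord0) ((1 - t) *: z + t *: y ord0).
  exists t; first by rewrite /= l0 t_le1.
  by rewrite scalerBr scalerBl scale1r addrA addrAC.
have [_ [[[s /= /andP[s0 s1] <-] Du] Uu]] :=
  segD z (y ord0) Dm (Dy ord0) _ segz _ Wm.
pose m' i := (1 - s) * m i.
have u_eq : z + s *: (y ord0 - z) = \sum_i ext s m' i *: y i.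
  rewrite ext_comb /m'; under [in RHS]eq_bigr do rewrite -scalerA.
  rewrite -scaler_sumr -/z scalerBr scalerBl scale1r.
  by rewrite addrCA.
rewrite u_eq in Du Uu; exists (ext s m'); split=> //.
- apply: (extP _ _ (fun _ => >= 0)) => // i.
  by rewrite mulr_ge0// subr_ge0.
- by rewrite ext_sum -mulr_sumr m1 mulr1 addrC subrK.
- apply: (extP _ _ (fun i a => l i = 0 -> a = 0)) => [/eqP|i li].
    by rewrite -/t (negPf t0).
  by rewrite /m' ml ?mulr0// /l' li mulr0.
Qed.

End Tvs.

(** * Interior of a convex cone *)

Section ConeInterior.
Context {R : realType} {Z : tvsType R} {C : set Z} (hC : convex_cone C).

Lemma minkowski_oppE (A : set Z) (z : Z) : minkowski_opp A z <-> A (- z).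
Proof.
by split=> [[a Aa <-]|Az]; [rewrite opprK|exists (- z); rewrite ?opprK].
Qed.

Lemma coneD (a b : Z) : C a -> C b -> C (a + b).
Proof. by move=> Ca Cb; rewrite -hC.2; exists a => //; exists b. Qed.

Lemma interior_coneD (a b : Z) : interior C a -> C b -> interior C (a + b).
Proof.
move=> Ca Cb.
have : nbhs (a + b) ((fun w => 1 *: w - b) @^-1` C).
  by apply: affine_continuous; rewrite scale1r addrK.
apply: filterS => w /=; rewrite scale1r => Cw.
by rewrite -(subrK b w); exact: coneD.
Qed.

Lemma interior_coneZ (t : R) (a : Z) :
  0 < t -> interior C a -> interior C (t *: a).
Proof.
move=> t0 Ca.
have : nbhs (t *: a) ((fun w => t^-1 *: w + 0) @^-1` C).
  by apply: affine_continuous; rewrite addr0 scalerA mulVf ?gt_eqF// scale1r.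
apply: filterS => w /=; rewrite addr0 => Cw.
have -> : w = t *: (t^-1 *: w) by rewrite scalerA mulfV ?gt_eqF// scale1r.
by apply: hC.1 => //; exact: ltW.
Qed.

(** An interior point makes [C] nonempty, so [C] contains [0], the value of an empty sum. *)
Lemma cone_sum (I : finType) (P : pred I) (v : I -> Z) :
  (forall i, P i -> C (v i)) -> interior C !=set0 -> C (\sum_(i | P i) v i).
Proof.
move=> Cv [a /interior_subset Ca].
apply: (big_ind C) => //; last exact: coneD.
by rewrite -(scale0r a); exact: hC.1.
Qed.

(** Some weight is positive and gives an interior term; adding the other terms, which lie in [C],
    keeps the sum interior. *)
Lemma interior_cone_combination (I : finType) (m : I -> R) (v : I -> Z) :
  (forall i, 0 <= m i) -> \sum_i m i = 1 ->
  (forall i, 0 < m i -> interior C (v i)) -> interior C (\sum_i m i *: v i).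
Proof.
move=> m0 m1 Cv.
have [i mi] : exists i, 0 < m i.
  apply/not_existsP => h; have : \sum_i m i <= 0.
    by apply: sumr_le0 => i _; rewrite leNgt; apply/negP.
  by rewrite m1 leNgt ltr01.
have Cmv : interior C (m i *: v i) by apply: interior_coneZ => //; exact: Cv.
rewrite (bigD1 i)//=; apply: interior_coneD => //.
apply: cone_sum => [j _|]; last by exists (v i); exact: Cv.
have [mj|mj] := ltP 0 (m j).
  by apply: hC.1 => //; apply: interior_subset; exact: Cv.
have -> : m j *: v j = 0 *: (m i *: v i).
  by rewrite scale0r (_ : m j = 0) ?scale0r//; apply/le_anti; rewrite mj m0.
by apply: hC.1 => //; exact: interior_subset.
Qed.

(** [- int C] is open and stable under subtracting [C], so it can itself serve as [V] in the
    definition of semicontinuity. *)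
Lemma usc_at_neg_interior (X : tvsType R) (K : set X) (g : X -> Z) (x : X) :
  usc_at C K g x -> minkowski_opp (interior C) (g x) ->
  \forall u \near x, K u -> minkowski_opp (interior C) (g u).
Proof.
move=> usc /minkowski_oppE gx.
have gV : nbhs (g x) ((fun w => - w) @^-1` interior C).
  by apply: opp_continuous; exact: nbhs_interior.
have [U Ux hU] := usc _ gV.
apply: filterS Ux => u Uu Ku; apply/minkowski_oppE.
have [v /= Cv [c Cc <-]] := hU u Uu Ku.
by rewrite opprB addrC; exact: interior_coneD.
Qed.

End ConeInterior.

(** * Weak vector equilibria on a compact convex set *)

Theorem theorem3p1 (R : realType) (X Z : tvsType R)
    (hX : hausdorff_space X) (hZ : hausdorff_space Z)
    (C : set Z) (hC : convex_cone C) (hCpointed : pointed C)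
    (hCint : interior C !=set0)
    (K : set X) (hK0 : K !=set0) (hKconvex : convex_set K)
    (hKcompact : compact K)
    (D : set X) (hD : self_segment_dense D K)
    (f : X -> X -> Z)
    (h1 : forall y : X, D y -> usc_on C K (fun x => f x y) K)
    (h2 : forall x : X, K x -> usc_on C K (fun y => f x y) (K `\` D))
    (h3 : forall x : X, D x -> cone_convex_on C D (fun y => f x y))
    (h4 : forall x : X, D x -> ~ minkowski_opp (interior C) (f x x)) :
  exists2 x0 : X, K x0 & forall y : X, K y -> ~ minkowski_opp (interior C) (f x0 y).
Proof.
have [DK DdK segD] := hD.
have Kcl : closed K by exact: compact_closed.
pose G y := K `&` [set x | ~ minkowski_opp (interior C) (f x y)].
have Gcl y : D y -> closed (G y).
  move=> Dy x clx.
  have Kx : K x by apply: Kcl; apply: closureS clx => ? [].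
  split=> // /(usc_at_neg_interior hC (h1 _ Dy _ Kx))/clx[u [[Ku nu] /(_ Ku)]].
  exact: nu.
have fin n (y : 'I_n.+1 -> X) : (forall i, D (y i)) ->
    exists x, forall i, G (y i) x.
  move=> Dy.
  pose comb (l : 'rV[R]_n.+1) := \sum_i l ord0 i *: y i.
  have dense_comb l U : simplex l -> nbhs (comb l) U ->
      exists m : 'I_n.+1 -> R,
        [/\ forall i, 0 <= m i, \sum_i m i = 1, forall i, l ord0 i = 0 -> m i = 0,
        D (\sum_i m i *: y i) & U (\sum_i m i *: y i)].
    by move=> [l0 l1]; exact: (combination_dense segD Dy l0 l1).
  have combK l : simplex l -> K (comb l).
    move=> ls; apply: Kcl => U /(dense_comb l U ls)[m [_ _ _ Dm Um]].
    by exists (\sum_i m i *: y i); split=> //; exact: DK.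
  have [||l ls hl] := @kkm R n (fun i => comb @^-1` G (y i)).
  - move=> i; apply: preimage_closed; last exact: Gcl.
    by move=> l _; exact: combination_continuous.
  - move=> l ls; apply/not_exists2P => none.
    have near_neg : \forall u \near comb l, forall i, 0 < l ord0 i -> K u ->
        minkowski_opp (interior C) (f u (y i)).
      apply: filter_forall => i; have [li|li] := ltP 0 (l ord0 i); last first.
        by near=> u.
      have [//|nG] := none i.
      have : minkowski_opp (interior C) (f (comb l) (y i)).
        by apply: contrapT => h; apply: nG; split=> //; exact: combK.
      move=> /(usc_at_neg_interior hC (h1 _ (Dy i) _ (combK l ls))).
      by apply: filterS => u hu _.
    (* The weights [m] vanish wherever [l] does, so [near_neg] applies to every [y i] of positive
       weight in [u]. *)
    have [m [m0 m1 ml Dm hm]] := dense_comb l _ ls near_neg.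
    set u := \sum_i m i *: y i in Dm hm.
    apply: (h4 _ Dm); apply/(minkowski_oppE).
    have := h3 u Dm _ y m Dy m0 m1 Dm; rewrite /cone_le -/u => Cu.
    have := interior_cone_combination hC (v := fun i => - f u (y i)) m0 m1.
    have neg i : 0 < m i -> interior C (- f u (y i)).
      move=> mi; apply/minkowski_oppE/hm; last exact: DK.
      rewrite lt_neqAle (ls.1 i) andbT; apply/eqP => li0.
      by rewrite ml ?ltxx in mi.
    (* Adding [Cu] to the combination of the [- f u (y i)] leaves [- f u u], now interior, against
       [h4]. *)
    move=> /(_ neg)/(interior_coneD hC)/(_ Cu).
    by under eq_bigr do rewrite scalerN; rewrite sumrN addKr.
  - by exists (comb l).
(* [compact_In0] wants a pointed space, hence this explicit filter. *)
pose F := filter_from [set s : seq X | forall y, y \in s -> D y]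
  (fun s => K `&` [set x | forall y, y \in s -> G y x]).
have FF : ProperFilter F.
  apply: filter_from_proper.
    apply: filter_from_filter; first by exists [::].
    move=> s s' Ds Ds'; exists (s ++ s').
      by move=> y; rewrite mem_cat => /orP[/Ds|/Ds'].
    move=> x [Kx hx].
    by split; split=> // y ys; apply: hx; rewrite mem_cat ys ?orbT.
  (* The empty family needs a point of [K]; [fin] handles at least one [y]. *)
  move=> [|y0 s] Ds; first by have [x Kx] := hK0; exists x.
  have [i|x hx] := fin (size s) (fun i => nth y0 (y0 :: s) i).
    by apply: Ds; rewrite mem_nth.
  have hxs y : y \in y0 :: s -> G y x.
    move=> ys; have ids : (index y (y0 :: s) < (size s).+1)%N by rewrite index_mem.
    by have := hx (Ordinal ids); rewrite nth_index.
  by exists x; split=> //; have [] := hxs y0 (mem_head _ _).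
have [|x0 [Kx0 clx0]] := hKcompact F FF; first by exists [::] => // x [].
have x0D y : D y -> G y x0.
  move=> Dy; apply: (Gcl y Dy) => U Ux0.
  apply: clx0 Ux0; exists [:: y] => [z|x [_ hx]]; first by rewrite inE => /eqP->.
  by apply: hx; rewrite inE.
exists x0 => // y Ky; have [/x0D[]//|nDy] := pselect (D y).
(* A value in [- int C] at [y] would spread to some [u] in [D] near [y], although [x0] lies in
   [G u]. *)
move=> /(usc_at_neg_interior hC (h2 _ Kx0 _ (conj Ky nDy)))/(DdK y Ky)[u [Du]].
by move=> /(_ (DK _ Du)); have [_] := x0D u Du.
Unshelve. all: by end_near. Qed.
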